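(* Let $G=(V,E)$ be any finite directed graph and let $s\in V$ be a start vertex. Then, in the two-handed tile assembly model with (possibly negative) glue strengths and a diagonal glue function described in the context, there exists an initial assembly set $T$ that walks $G$ (from start vertex $s$, with respect to some label $\ell$) and is fuel efficient. Further, $T$ contains at most $O(|V|+|E|)$ distinct assemblies, each of $O(1)$ size (number of tiles bounded by a constant independent of $G$).
   Context: Model. Fix an alphabet $\Pi$ of glue types; each $g\in\Pi$ has a rational strength $str(g)$, which may be negative. A tile is a unit square of fixed orientation (no rotation) with at most one glue type on each face, placed at the center of that face; a tile may also carry a finite string label. An assembly is a set of tiles placed in the plane with pairwise non-overlapping interiors. The bond graph $G_\Upsilon$ of an assembly $\Upsilon$ has the tiles as vertices, and the weight of the edge between two tiles is the sum of strengths of the overlapping glue points of the two tiles that have equal glue type (overlapping glues of different types contribute $0$; this is the diagonal glue function). An assembly $C$ is stable if the min-cut of $G_C$ is at least $1$, and unstable otherwise. $C$ is breakable into $A$ and $B$ if $G_C$ has a cut separating it into $A$ and $B$ of weight less than $1$. Assemblies $A$ and $B$ are combinable into $C$ if some translate $B'$ of $B$ satisfies that $C=A\cup B'$ is an assembly (no overlaps) and the cut of $G_{A\cup B'}$ into $A$ and $B'$ has weight at least $1$ ($C$ need not be stable). For an initial assembly set $T$ (whose elements are stable assemblies), the set $\texttt{PROD}_T$ of producible assemblies is the smallest set containing $T$ such that whenever $A,B\in\texttt{PROD}_T$ are combinable into $C$ then $C\in\texttt{PROD}_T$, and whenever $C\in\texttt{PROD}_T$ is breakable into $A$ and $B$ then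 $A,B\in\texttt{PROD}_T$. $|a|$ denotes the number of tiles of assembly $a$. Assembly sequences. A valid assembly sequence for $T$ is a sequence $S=\langle a_1,\dots,a_k\rangle$ with each $a_i\in\texttt{PROD}_T$ such that for each $i<k$, either $a_i$ is combinable with some $b\in\texttt{PROD}_T$ into $a_{i+1}$, or $a_i$ is breakable into $a_{i+1}$ and some assembly $b$. It is $\ell$-focused (for a label $\ell$) if every $a_i$ contains at least one tile with label $\ell$, and nascent if $a_1\in T$. For a partial function $f:\texttt{PROD}_T\to V$, $f'(\langle a_1,\dots,a_k\rangle)$ is the sequence obtained by replacing each $a_i$ by $f(a_i)$ when defined and deleting $a_i$ otherwise. Walking. Given a directed graph $G=(V,E)$, start vertex $s$, and an initial assembly set $T$ in which some tiles are labeled $\ell$, $T$ walks $G$ if there is a partial function $f:\texttt{PROD}_T\to V$ such that: (1) for every $\ell$-focused nascent valid assembly sequence $S$ of $T$, $f'(S)$ is a valid walk in $G$ starting at $s$; (2) for every walk $W$ in $G$ starting at $s$, there is a nascent $\ell$-focused valid assembly sequence $S$ with $f'(S)=W$; (3) for every edge $(u,v)\in E$ and every $\ell$-focused valid assembly sequence $S$ with $f'(S)=\langle u\rangle$, there is an $\ell$-focused valid assembly sequence $R$ having $S$ as a prefix with $f'(R)=\langle u,v\rangle$. Fuel. For assemblies $a,b$, $fuel(a,b)=|b|-|a|$ if $|b|\ge|a|$ and $0$ otherwise; for $A=\langle a_1,\dots,a_k\rangle$, $fuel(A)=\sum_{i=1}^{k-1} fuel(a_i,a_{i+1})$. A $T$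 walking $G$ is fuel efficient if there is a constant $c$ such that for all $\ell$-focused nascent valid assembly sequences $S$, $fuel(S)/|f'(S)|\le c$ (i.e. $fuel(S)/|f'(S)|=O(1)$). *)

(* Defs.v *)
From HB Require Import structures.
From mathcomp Require Import all_boot all_order all_algebra.
From mathcomp Require Import finmap.
Set Implicit Arguments. Unset Strict Implicit. Unset Printing Implicit Defensive.
Import Order.TTheory GRing.Theory Num.Theory.
Local Open Scope fset_scope.
Local Open Scope ring_scope.

(** Glue types are natural numbers; a glue slot on a face is [option glue]
    ([None] = no glue).  A strength function [str : glue -> rat] is part of
    the tile system (strengths may be negative). *)
Definition glue := nat.

(** A tile: glues on (north, east, south, west) faces, and an optional label
    (labels are encoded as natural numbers). No rotation. *)
Definition tile : Type :=
  (option glue * option glue * option glue * option glue * option nat)%type.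
Definition tN (t : tile) : option glue := t.1.1.1.1.
Definition tE (t : tile) : option glue := t.1.1.1.2.
Definition tS (t : tile) : option glue := t.1.1.2.
Definition tW (t : tile) : option glue := t.1.2.
Definition tlabel (t : tile) : option nat := t.2.

(** A placed tile: integer position (x, y) (y grows to the north) and a tile. *)
Definition ptile : Type := ((int * int) * tile)%type.

Definition assembly : Type := {fset ptile}.

Definition no_overlap (A : assembly) : Prop :=
  forall x y, x \in A -> y \in A -> x.1 = y.1 -> x = y.

Definition is_assembly (A : assembly) : Prop := A != fset0 /\ no_overlap A.

Definition gmatch (str : glue -> rat) (g h : option glue) : rat :=
  match g, h with
  | Some a, Some b => if a == b then str a else 0
  | _, _ => 0
  end.

Definition bond (str : glue -> rat) (x y : ptile) : rat :=
  let: ((px, py), tx) := x in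
  let: ((qx, qy), ty) := y in
  if (qx == px + 1) && (qy == py) then gmatch str (tE tx) (tW ty)
  else if (qx == px - 1) && (qy == py) then gmatch str (tW tx) (tE ty)
  else if (qx == px) && (qy == py + 1) then gmatch str (tN tx) (tS ty)
  else if (qx == px) && (qy == py - 1) then gmatch str (tS tx) (tN ty)
  else 0.

Definition cutw (str : glue -> rat) (X Y : assembly) : rat :=
  \sum_(x <- X) \sum_(y <- Y) bond str x y.

Definition is_cut (C X Y : assembly) : Prop :=
  [/\ X != fset0, Y != fset0, [disjoint X & Y] & X `|` Y = C].

Definition stable (str : glue -> rat) (C : assembly) : Prop :=
  forall X Y, is_cut C X Y -> 1 <= cutw str X Y.

Definition breakable (str : glue -> rat) (C A B : assembly) : Prop :=
  is_cut C A B /\ cutw str A B < 1.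

Definition shift (d : int * int) (x : ptile) : ptile :=
  ((x.1.1 + d.1, x.1.2 + d.2), x.2).
Definition translate (d : int * int) (B : assembly) : assembly :=
  [fset shift d x | x in B].

Definition combinable (str : glue -> rat) (A B C : assembly) : Prop :=
  exists d : int * int,
    let B' := translate d B in
    [/\ no_overlap (A `|` B'), [disjoint A & B'], C = A `|` B'
      & 1 <= cutw str A B'].

Inductive PROD (str : glue -> rat) (T : {fset assembly}) : assembly -> Prop :=
| PROD_init a : a \in T -> PROD str T a
| PROD_comb a b c : PROD str T a -> PROD str T b -> combinable str a b c ->
    PROD str T c
| PROD_brk1 c a b : PROD str T c -> breakable str c a b -> PROD str T a
| PROD_brk2 c a b : PROD str T c -> breakable str c a b -> PROD str T b.

Definition seq_step (str : glue -> rat) (T : {fset assembly}) (a a' : assembly)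
  : Prop :=
  (exists b, PROD str T b /\ combinable str a b a') \/
  (exists b, breakable str a a' b).

Fixpoint steps (str : glue -> rat) (T : {fset assembly}) (S : seq assembly)
  : Prop :=
  match S with
  | a :: ((a' :: _) as S') => seq_step str T a a' /\ steps str T S'
  | _ => True
  end.

Definition valid_seq (str : glue -> rat) (T : {fset assembly}) (S : seq assembly)
  : Prop :=
  S <> [::] /\ (forall a, a \in S -> PROD str T a) /\ steps str T S.

Definition has_label (l : nat) (a : assembly) : Prop :=
  exists x, x \in a /\ tlabel x.2 = Some l.

Definition focused (l : nat) (S : seq assembly) : Prop :=
  forall a, a \in S -> has_label l a.

Definition nascent (T : {fset assembly}) (S : seq assembly) : Prop :=
  exists a S', S = a :: S' /\ a \in T.

Definition is_walk (V : finType) (E : rel V) (s : V) (W : seq V) : Prop :=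
  exists W', W = s :: W' /\ path E s W'.

Definition fprime (V : Type) (f : assembly -> option V) (S : seq assembly)
  : seq V := pmap f S.

Definition walks (str : glue -> rat) (T : {fset assembly}) (l : nat)
  (V : finType) (E : rel V) (s : V) (f : assembly -> option V) : Prop :=
  [/\ (forall S, valid_seq str T S -> focused l S -> nascent T S ->
          is_walk E s (fprime f S)),
      (forall W, is_walk E s W -> exists S,
          [/\ valid_seq str T S, focused l S, nascent T S & fprime f S = W])
    & (forall u v, E u v -> forall S, valid_seq str T S -> focused l S ->
          fprime f S = [:: u] -> exists R',
          [/\ valid_seq str T (S ++ R'), focused l (S ++ R')
            & fprime f (S ++ R') = [:: u; v]])].

Definition fuel (a b : assembly) : nat := (#|` b| - #|` a|)%N.

Fixpoint fuel_seq (S : seq assembly) : nat :=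
  match S with
  | a :: ((b :: _) as S') => (fuel a b + fuel_seq S')%N
  | _ => 0%N
  end.

(** Fuel efficiency: fuel(S) / |f'(S)| <= c, written without division. *)
Definition fuel_efficient (str : glue -> rat) (T : {fset assembly}) (l : nat)
  (V : Type) (f : assembly -> option V) : Prop :=
  exists c : nat, forall S, valid_seq str T S -> focused l S -> nascent T S ->
    (fuel_seq S <= c * size (fprime f S))%N.

Definition initial_ok (str : glue -> rat) (T : {fset assembly}) : Prop :=
  forall a, a \in T -> is_assembly a /\ stable str a.

Definition num_edges (V : finType) (E : rel V) : nat :=
  #|[set e : V * V | E e.1 e.2]|.

(* Main.v *)
(** Bricks are dominoes laid in two rows, each row shifted by one cell against
    the other, so that brick [n] touches exactly brick [n - 1] (vertically) and
    brick [n - 2] (horizontally), each with strength 1/2.  There is one brick for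
    every edge [(u, v)] and every row: the vertical contact checks [u] and
    announces [v], the horizontal one is anonymous.  The walker is a growing
    ribbon of bricks ending on its current vertex.  A loose brick meets the two
    last bricks of a ribbon with total strength 1, but two loose bricks share at
    most one contact, and two ribbons expose no complementary glues; hence a
    ribbon grows only by one edge at a time.  No glue is negative, so everything
    producible is stable and nothing ever breaks: each step of the walk costs two
    tiles of fuel. *)

Require Import Defs.
From mathcomp Require Import all_boot all_order all_algebra.
From mathcomp Require Import finmap.
From mathcomp Require Import zify lra.
Local Open Scope fset_scope.

Set Implicit Arguments.
Unset Strict Implicit.
Unset Printing Implicit Defensive.
Import Order.TTheory GRing.Theory Num.Theory.

(** * Non-negative sums, directions and faces *)

Lemma ler_sum_fsubset (R : numDomainType) (I : choiceType) (A B : {fset I})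
    (F : I -> R) :
  B `<=` A -> (forall x, x \in A -> 0 <= F x)%R ->
  (\sum_(x <- B) F x <= \sum_(x <- A) F x)%R.
Proof.
move=> sBA F_ge0.
have ->: B = [fset x in A | x \in B].
  by apply/fsetP=> x; rewrite !inE /= andbC; case: (boolP (x \in B)) => //= /(fsubsetP sBA).
rewrite (big_fsetID _ (mem B) A) /= lerDl big_seq sumr_ge0 // => x.
by rewrite !inE => /andP[/F_ge0].
Qed.

Section Directions.

Local Open Scope ring_scope.

Variant dir := North | East | South | West.

Definition opp_dir (d : dir) : dir :=
  match d with North => South | East => West | South => North | West => East end.

Definition move (d : dir) (p : int * int) : int * int :=
  match d with
  | North => (p.1, p.2 + 1)
  | East => (p.1 + 1, p.2)
  | South => (p.1, p.2 - 1)
  | West => (p.1 - 1, p.2)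
  end.

Definition face (d : dir) (t : tile) : option glue :=
  match d with North => tN t | East => tE t | South => tS t | West => tW t end.

Lemma opp_dirK : involutive opp_dir.
Proof. by case. Qed.

Lemma moveK d : cancel (move d) (move (opp_dir d)).
Proof. by case: d => -[x y] /=; congr (_, _); lia. Qed.

End Directions.

(** * Bonds, cut weights and stability *)

Section Bonds.

Local Open Scope ring_scope.

Variable str : glue -> rat.

Lemma bond_move d g x y :
  y.1 = move d x.1 -> face d x.2 = Some g -> face (opp_dir d) y.2 = Some g ->
  bond str x y = str g.
Proof.
case: x y => [[px py] tx] [[qx qy] ty] /= [].
case: d => -[-> ->] /= ex ey; repeat (case: ifP => ?; try (exfalso; lia));
  by rewrite /gmatch ex ey eqxx.
Qed.

(** Converse of [bond_move]: from here on contacts are analysed by direction and common glue instead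
    of by coordinates. *)
Lemma bond_neq0 x y : bond str x y != 0 ->
  exists d g, [/\ y.1 = move d x.1, face d x.2 = Some g,
    face (opp_dir d) y.2 = Some g & bond str x y = str g].
Proof.
case: x y => [[px py] tx] [[qx qy] ty] /=.
have gm g h : gmatch str g h != 0 ->
    exists a, [/\ g = Some a, h = Some a & gmatch str g h = str a].
  case: g h => [a|] [b|] //=; rewrite ?eqxx //; case: (a =P b) => [<-|_];
    rewrite ?eqxx // => _; by exists a.
case: ifP => [/andP[/eqP-> /eqP->] /gm[a [? ? ->]]|_]; first by exists East, a.
case: ifP => [/andP[/eqP-> /eqP->] /gm[a [? ? ->]]|_]; first by exists West, a.
case: ifP => [/andP[/eqP-> /eqP->] /gm[a [? ? ->]]|_]; first by exists North, a.
case: ifP => [/andP[/eqP-> /eqP->] /gm[a [? ? ->]]|_]; first by exists South, a.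
by rewrite eqxx.
Qed.

Lemma bondC x y : bond str x y = bond str y x.
Proof.
(* It suffices to reverse a non-zero bond: if both orders vanish, they agree. *)
have half u v : bond str u v != 0 -> bond str v u = bond str u v.
  case/bond_neq0=> d [g [uv fu fv ->]].
  by apply: (@bond_move (opp_dir d)) => //; rewrite ?opp_dirK // uv moveK.
have [xy0|/half//] := eqVneq (bond str x y) 0.
have [yx0|/half//] := eqVneq (bond str y x) 0.
by rewrite xy0 yx0.
Qed.

Lemma cutwC X Y : cutw str X Y = cutw str Y X.
Proof.
by rewrite /cutw exchange_big; apply: eq_bigr => y _; apply: eq_bigr => x _; apply: bondC.
Qed.

Hypothesis str_ge0 : forall g, 0 <= str g.

Lemma bond_ge0 x y : 0 <= bond str x y.
Proof. by have [->|/bond_neq0[d [g [_ _ _ ->]]]] := eqVneq (bond str x y) 0. Qed.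

Lemma ler_cutw (X X' Y Y' : assembly) :
  X `<=` X' -> Y `<=` Y' -> cutw str X Y <= cutw str X' Y'.
Proof.
move=> sX sY; apply: (@le_trans _ _ (\sum_(x <- X') \sum_(y <- Y) bond str x y)).
  apply: ler_sum_fsubset => // x _; apply: sumr_ge0 => y _; exact: bond_ge0.
by apply: ler_sum => x _; apply: ler_sum_fsubset => // y _; apply: bond_ge0.
Qed.

Lemma stable1 x : stable str [fset x].
Proof.
move=> X Y [/fset0Pn[a aX] /fset0Pn[b bY] /fdisjointP dXY eXY]; exfalso.
have : a \in X `|` Y by rewrite inE aX.
have : b \in X `|` Y by rewrite inE bY orbT.
rewrite eXY !inE => /eqP eb /eqP ea; subst.
by have := dXY _ aX; rewrite bY.
Qed.

(** A cut of the union either splits one of the parts, and then restricts to a cut of that part, or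
    separates exactly [A] from [B]. Since bonds are non-negative, restricting a cut only lowers its
    weight. *)
Lemma stableU A B :
  A != fset0 -> B != fset0 -> [disjoint A & B] ->
  stable str A -> stable str B -> 1 <= cutw str A B -> stable str (A `|` B).
Proof.
move=> A0 B0 dAB stA stB cAB X Y [X0 Y0 dXY eXY].
have sub C : C `<=` A `|` B -> stable str C ->
    X `&` C != fset0 -> Y `&` C != fset0 -> 1 <= cutw str X Y.
  move=> sC stC XC YC.
  apply: le_trans (ler_cutw (fsubsetIl X C) (fsubsetIl Y C)); apply: stC; split=> //.
    by apply/fdisjointP=> z; rewrite !inE => /andP[/(fdisjointP dXY)/negbTE-> _].
  by rewrite -fsetIUl eXY; apply/fsetIidPr.
have memXY z : z \in A `|` B -> (z \in X) || (z \in Y) by rewrite -eXY inE.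
have notin_sub (Z W C : assembly) : Z `&` C = fset0 -> C `<=` Z `|` W -> C `<=` W.
  move=> ZC /fsubsetP sC; apply/fsubsetP=> z zC.
  have := sC _ zC; rewrite inE => /orP[zZ|//].
  have : z \in Z `&` C by rewrite inE zZ.
  by rewrite ZC inE.
have sA : A `<=` A `|` B := fsubsetUl A B.
have sB : B `<=` A `|` B := fsubsetUr A B.
have sAX : A `<=` X `|` Y by rewrite eXY.
have sBX : B `<=` X `|` Y by rewrite eXY.
have [XA|XA] := eqVneq (X `&` A) fset0; last have [YA|YA] := eqVneq (Y `&` A) fset0.
(* Here [A] lies in [Y]. As [X] is not empty, it must meet [B], so [B] is either split or equal to
   the other side of the cut. *)
- have AY := notin_sub _ _ _ XA sAX.
  have [XB|XB] := eqVneq (X `&` B) fset0; last have [YB|YB] := eqVneq (Y `&` B) fset0.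
  + case/fset0Pn: X0 => z zX; have : z \in A `|` B by rewrite -eXY inE zX.
    rewrite inE => /orP[zA|zB].
      have : z \in X `&` A by rewrite inE zX.
      by rewrite XA inE.
    have : z \in X `&` B by rewrite inE zX.
    by rewrite XB inE.
  + have BX : B `<=` X by apply: (notin_sub Y); rewrite // fsetUC.
    by apply: le_trans cAB _; rewrite cutwC; apply: ler_cutw.
  + exact: (sub B).
- have AX : A `<=` X by apply: (notin_sub Y); rewrite // fsetUC.
  have [YB|YB] := eqVneq (Y `&` B) fset0; last have [XB|XB] := eqVneq (X `&` B) fset0.
  + case/fset0Pn: Y0 => z zY; have : z \in A `|` B by rewrite -eXY inE zY orbT.
    rewrite inE => /orP[zA|zB].
      have : z \in Y `&` A by rewrite inE zY.
      by rewrite YA inE.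
    have : z \in Y `&` B by rewrite inE zY.
    by rewrite YB inE.
  + have BY : B `<=` Y by apply: (notin_sub X).
    by apply: le_trans cAB _; apply: ler_cutw.
  + exact: (sub B).
- exact: (sub A).
Qed.

Lemma bond_le_cutw (A B : assembly) x y :
  x \in A -> y \in B -> bond str x y <= cutw str A B.
Proof.
move=> xA yB; apply: le_trans (ler_cutw (X := [fset x]) (Y := [fset y]) _ _);
  rewrite ?fsub1set //.
by rewrite /cutw !big_seq_fset1.
Qed.

Lemma bond2_le_cutw (A B : assembly) x1 x2 y :
  x1 \in A -> x2 \in A -> y \in B -> x1 != x2 ->
  bond str x1 y + bond str x2 y <= cutw str A B.
Proof.
move=> x1A x2A yB x12; rewrite /cutw (big_fsetD1 x1 x1A) /=.
have x2A' : x2 \in A `\ x1 by rewrite !inE eq_sym x12.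
have le_row x : bond str x y <= \sum_(z <- B) bond str x z.
  by rewrite (big_fsetD1 y yB) lerDl sumr_ge0 // => z _; apply: bond_ge0.
rewrite (big_fsetD1 x2 x2A') /= addrA; apply: le_trans (lerD (le_row x1) (le_row x2)) _.
by rewrite lerDl sumr_ge0 // => x _; apply: sumr_ge0 => z _; apply: bond_ge0.
Qed.

(** The two bonds differ as pairs but may share a tile, as when one loose tile touches two tiles of
    a ribbon. *)
Definition cooperates (A B : assembly) : Prop :=
  exists x1 y1 x2 y2, [/\ (x1, y1) <> (x2, y2), x1 \in A /\ x2 \in A,
    y1 \in B /\ y2 \in B, bond str x1 y1 != 0 & bond str x2 y2 != 0].

Lemma cutw_cooperates (A B : assembly) :
  (forall x y, x \in A -> y \in B -> bond str x y < 1) ->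
  1 <= cutw str A B -> cooperates A B.
Proof.
move=> lt1 ge1.
have eP : cutw str A B = \sum_(p <- [seq (x, y) | x <- A, y <- B]) bond str p.1 p.2.
  by rewrite /cutw big_allpairs_dep.
have Puniq : uniq [seq (x, y) | x <- A, y <- B].
  by apply: allpairs_uniq; rewrite ?fset_uniq // => -[? ?] [? ?].
have [/hasP[p1 p1P b1]|/hasPn none] :=
    boolP (has (fun p => bond str p.1 p.2 != 0) [seq (x, y) | x <- A, y <- B]); last first.
  move: ge1; rewrite eP big1_seq ?ler10 // => p /andP[_ /none]; rewrite negbK => /eqP //.
(* With the first bonded pair removed, a second one must remain; otherwise the cut would weigh as
   much as a single bond, which is below 1. *)
have [/hasP[p2]|/hasPn none] :=
    boolP (has (fun p => bond str p.1 p.2 != 0) (rem p1 [seq (x, y) | x <- A, y <- B])).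
  rewrite mem_rem_uniq // inE => /andP[p21 /allpairsP[[x2 y2] [/= x2A y2B e2]]] b2.
  case/allpairsP: p1P => -[x1 y1] [/= x1A y1B e1]; subst.
  exists x1, y1, x2, y2; split=> // e; by rewrite e eqxx in p21.
move: ge1; rewrite eP (big_rem p1) //= [X in _ + X]big1_seq; last first.
  by move=> p /andP[_ /none]; rewrite negbK => /eqP.
case/allpairsP: p1P => -[x1 y1] [/= x1A y1B ->] /=; rewrite addr0.
by have := lt1 _ _ x1A y1B; case: ltgtP.
Qed.

End Bonds.

(** * Exposed glues *)

(** Stronger than disjointness of the sets: two different tiles on the same cell overlap although
    they are distinct elements. *)
Definition apart (A B : assembly) : Prop :=
  forall x y, x \in A -> y \in B -> x.1 <> y.1.

(** Only a glue facing an empty cell can bond to an assembly that does not overlap [A], so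
    combinations are decided by a few free faces. *)
Definition exposed (A : assembly) (x : ptile) (d : dir) (g : glue) : Prop :=
  [/\ x \in A, face d x.2 = Some g & forall y, y \in A -> y.1 <> move d x.1].

Lemma bond_exposed str (A B : assembly) x y :
  apart A B ->
  x \in A -> y \in B -> bond str x y != 0%R ->
  exists d g, [/\ y.1 = move d x.1, exposed A x d g, exposed B y (opp_dir d) g
    & bond str x y = str g].
Proof.
move=> dAB xA yB /bond_neq0[d [g [yx fx fy ->]]].
exists d, g; split=> //; split=> // z zAB.
  by rewrite -yx; apply: dAB.
by rewrite yx moveK => e; apply: (dAB x z).
Qed.

Lemma translateU c A B : translate c (A `|` B) = translate c A `|` translate c B.
Proof. exact: imfsetU. Qed.

Lemma translate1 c x : translate c [fset x] = [fset shift c x].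
Proof. exact: imfset_fset1. Qed.

(** * Bricks, seed and ribbons *)

Section Tiles.

Local Open Scope ring_scope.

Variables (V : finType) (E : rel V) (s : V).

(** Glue [0] is internal to bricks and to the seed, glue [1] is the anonymous
    horizontal glue, and [vglue v b] announces, on a brick of parity [b], that
    the current vertex is [v]. *)
Definition vglue (v : V) (b : bool) : glue := ((enum_rank v).*2 + b).+2.

(** The threshold being 1, glue [0] binds alone, while any other glue needs a second contact. *)
Definition half_str (g : glue) : rat := if g == 0%N then 1 else 1 / 2%:R.

(** Bricks of parity [false] lie in the lower row of the ribbon. *)
Definition toward (b : bool) : dir := if b then South else North.

(** A left half carries the vertex glue of the opposite parity, a right half that of its own parity;
    vertically, a left half can thus bond only to a right half of the other row. *)
Definition ltile (b : bool) (u : V) : tile :=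
  if b then (None, Some 0%N, Some (vglue u false), Some 1%N, None)
  else (Some (vglue u true), Some 0%N, None, Some 1%N, None).

Definition rtile (b : bool) (v : V) : tile :=
  if b then (None, Some 1%N, Some (vglue v true), Some 0%N, None)
  else (Some (vglue v false), Some 1%N, None, Some 0%N, None).

Definition brick (b : bool) (u v : V) (p : int * int) : assembly :=
  [fset (p, ltile b u)] `|` [fset (move East p, rtile b v)].

(** A brick with right half at [p], preceded by the right half of another one. *)
Definition seed (p : int * int) : assembly :=
  [fset (move North (move West p),
         (None, Some 1%N, Some 0%N, None, Some 0%N) : tile)] `|`
  ([fset (move West p, (Some 0%N, Some 0%N, None, None, None) : tile)] `|`
   [fset (p, rtile false s)]).

(** [walker v b p A]: the last brick of the ribbon [A] has parity [b] and its
    right half lies at [p]. *)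
Inductive walker : V -> bool -> int * int -> assembly -> Prop :=
| walker_seed p : walker s false p (seed p)
| walker_step u v b p A : walker u b p A -> E u v ->
    walker v (~~ b) (move East (move (toward b) p))
      (A `|` brick (~~ b) u v (move (toward b) p)).

Lemma half_str_ge0 g : 0 <= half_str g.
Proof. by rewrite /half_str; case: ifP => _; [apply: ler01|apply: divr_ge0]. Qed.

Lemma vglue_inj u v b c : vglue u b = vglue v c -> u = v /\ b = c.
Proof.
move=> [] e; have eb : b = c by case: b c e => -[] //=; lia.
subst c; split=> //; apply: enum_rank_inj; apply: ord_inj.
by move/eqP: e; rewrite eqn_add2r => /eqP/double_inj.
Qed.

Lemma face_ltile d b u g : face d (ltile b u) = Some g ->
  [\/ d = East /\ g = 0%N, d = West /\ g = 1%N | d = toward b /\ g = vglue u (~~ b)].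
Proof.
by case: d b => -[] // [<-];
  do [by constructor 1|by constructor 2|by constructor 3].
Qed.

Lemma face_rtile d b v g : face d (rtile b v) = Some g ->
  [\/ d = West /\ g = 0%N, d = East /\ g = 1%N | d = toward b /\ g = vglue v b].
Proof.
by case: d b => -[] // [<-];
  do [by constructor 1|by constructor 2|by constructor 3].
Qed.

Lemma toward_opp b : opp_dir (toward b) = toward (~~ b).
Proof. by case: b. Qed.

Lemma shift_move c d p t : shift c (move d p, t) = (move d (shift c (p, t)).1, t).
Proof. by case: d => /=; congr (_, _, _); rewrite /=; lia. Qed.

Lemma translate_brick c b u v p :
  translate c (brick b u v p) = brick b u v (p.1 + c.1, p.2 + c.2).
Proof.
by rewrite /brick translateU; apply: f_equal2; rewrite translate1 ?shift_move /shift.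
Qed.

Lemma translate_seed c p : translate c (seed p) = seed (p.1 + c.1, p.2 + c.2).
Proof.
rewrite /seed translateU; apply: f_equal2.
  by rewrite translate1 !shift_move /shift.
by rewrite translateU; apply: f_equal2; rewrite translate1 ?shift_move /shift.
Qed.

Lemma translate_walker c v b p A :
  walker v b p A -> walker v b (p.1 + c.1, p.2 + c.2) (translate c A).
Proof.
elim=> [{}p|{A p}u w {}b p A _ IH uw].
  rewrite translate_seed; exact: walker_seed.
rewrite translateU translate_brick.
have mv d q : ((move d q).1 + c.1, (move d q).2 + c.2) = move d (q.1 + c.1, q.2 + c.2).
  by case: d => /=; congr (_, _); lia.
by rewrite !mv; apply: walker_step.
Qed.

Lemma mem_brick x b u v p :
  x \in brick b u v p <-> x = (p, ltile b u) \/ x = (move East p, rtile b v).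
Proof.
split; first by case/fsetUP=> /fset1P ->; [left|right].
by case=> ->; apply/fsetUP; [left|right]; apply: fset11.
Qed.

Lemma brick_exposed b u v p x d g : exposed (brick b u v p) x d g ->
  [\/ [/\ x = (p, ltile b u), d = West & g = 1%N],
      [/\ x = (p, ltile b u), d = toward b & g = vglue u (~~ b)],
      [/\ x = (move East p, rtile b v), d = East & g = 1%N]
    | [/\ x = (move East p, rtile b v), d = toward b & g = vglue v b]].
Proof.
have lB : (p, ltile b u) \in brick b u v p by apply/mem_brick; left.
have rB : (move East p, rtile b v) \in brick b u v p by apply/mem_brick; right.
case=> /mem_brick[]-> /=.
  case/face_ltile=> -[-> ->] nA; [|by constructor 1|by constructor 2].
  by case: (nA _ rB).
case/face_rtile=> -[-> ->] nA; [|by constructor 3|by constructor 4].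
by case: (nA _ lB); rewrite (moveK East).
Qed.

(** * Absence of overlap and stability of bricks and seed *)

Lemma no_overlapU A B :
  no_overlap A -> no_overlap B -> apart A B ->
  no_overlap (A `|` B).
Proof.
move=> nA nB nAB x y; rewrite !inE => /orP[xA|xB] /orP[yA|yB] e.
- exact: nA.
- by case: (nAB _ _ xA yB).
- by case: (nAB _ _ yA xB).
- exact: nB.
Qed.

Lemma no_overlap1 x : no_overlap [fset x].
Proof. by move=> y z; move=> /fset1P-> /fset1P->. Qed.

Lemma move_neq d p : move d p <> p.
Proof. by case: d p => -[x y] [] /=; lia. Qed.

Lemma move_diag_neq p : move North (move West p) <> p.
Proof. by case: p => x y [] /=; lia. Qed.

Lemma brick_no_overlap b u v p : no_overlap (brick b u v p).
Proof.
apply: no_overlapU; [exact: no_overlap1|exact: no_overlap1|].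
by move=> x y /fset1P-> /fset1P-> e; case: (move_neq (esym e)).
Qed.

Lemma disjoint_pos (A B : assembly) :
  apart A B -> [disjoint A & B].
Proof. by move=> h; apply/fdisjointP => x xA; apply/negP => /(h x x xA). Qed.

Lemma fset1_neq0 (x : ptile) : [fset x] != fset0.
Proof. by apply/fset0Pn; exists x; rewrite inE. Qed.

Lemma fsetU_neq0 (A B : assembly) : A != fset0 -> A `|` B != fset0.
Proof. by case/fset0Pn=> x xA; apply/fset0Pn; exists x; rewrite inE xA. Qed.

Lemma stable_pos_U A B : A != fset0 -> B != fset0 ->
  apart A B ->
  stable half_str A -> stable half_str B -> 1 <= cutw half_str A B ->
  stable half_str (A `|` B).
Proof. by move=> A0 B0 /disjoint_pos; apply: stableU => //; apply: half_str_ge0. Qed.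

Lemma brick_stable b u v p : stable half_str (brick b u v p).
Proof.
apply: stable_pos_U; [exact: fset1_neq0|exact: fset1_neq0| |exact: stable1|exact: stable1|].
  by move=> x y /fset1P-> /fset1P-> e; case: (move_neq (esym e)).
apply: le_trans (bond_le_cutw half_str_ge0 (fset11 _) (fset11 _)).
by rewrite (@bond_move _ East 0%N) //; case: b.
Qed.

Lemma seed_no_overlap_stable p : no_overlap (seed p) /\ stable half_str (seed p).
Proof.
rewrite /seed.
set x := (move North _, _); set y := (move West p, _); set z := (p, _).
have dyz a b : a \in [fset y] -> b \in [fset z] -> a.1 <> b.1.
  by move=> /fset1P-> /fset1P-> e; case: (move_neq e).
have dxyz a b : a \in [fset x] -> b \in [fset y] `|` [fset z] -> a.1 <> b.1.
  move=> /fset1P-> /fsetUP[] /fset1P-> e; [case: (move_neq e)|case: (move_diag_neq e)].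
split.
  apply: (no_overlapU _ _ dxyz); first exact: no_overlap1.
  by apply: (no_overlapU _ _ dyz); exact: no_overlap1.
apply: (stable_pos_U _ _ dxyz); [exact: fset1_neq0| |exact: stable1| |].
- exact/fsetU_neq0/fset1_neq0.
- apply: (stable_pos_U _ _ dyz);
    [exact: fset1_neq0|exact: fset1_neq0|exact: stable1|exact: stable1|].
  apply: le_trans (bond_le_cutw half_str_ge0 (fset11 _) (fset11 _)).
  by rewrite (@bond_move _ East 0%N) //; apply: (esym (moveK West p)).
- have yU : y \in [fset y] `|` [fset z] by apply/fsetUP; left; apply: fset11.
  apply: le_trans (bond_le_cutw half_str_ge0 (fset11 _) yU).
  by rewrite (@bond_move _ South 0%N) //; apply: (esym (moveK North _)).
Qed.

(** * Geometry of ribbons *)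

Lemma move_back b p :
  move (toward (~~ b)) (move West (move East (move (toward b) p))) = p.
Proof. by rewrite (moveK East) -toward_opp moveK. Qed.

Lemma move_toward_fst b p : (move (toward b) p).1 = p.1.
Proof. by case: b. Qed.

(** The head is alone in the rightmost column, so the cells of the next brick, in that column and
    the one after it, are free. *)
Lemma walker_bound v b p A x : walker v b p A -> x \in A -> x.1.1 < p.1 \/ x.1 = p.
Proof.
move=> wA; elim: wA x => {A p} [p|u w {}b p A _ IH _] x.
  case/fsetUP=> [/fset1P->|/fsetUP[]/fset1P->]; [left|left|by right];
    by rewrite /= ltrBlDr ltrDl.
case/fsetUP=> [/IH[lt|->]|/mem_brick[]->]; [left|left|left|by right];
  rewrite /= move_toward_fst ?ltrDl //.
by apply: lt_trans lt _; rewrite ltrDl.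
Qed.

Lemma walker_head v b p A : walker v b p A -> (p, rtile b v) \in A.
Proof.
case=> [{}p|u w {}b {}p {}A _ _]; first by do 2 (apply/fsetUP; right); apply: fset11.
by apply/fsetUP; right; apply/mem_brick; right.
Qed.

(** The second contact awaiting the next brick: the anonymous east glue diagonally behind the
    head. *)
Lemma walker_prev v b p A : walker v b p A ->
  exists t, (move (toward b) (move West p), t) \in A /\ face East t = Some 1%N.
Proof.
case=> [{}p|u w {}b {}p {}A /walker_head hA _].
  by eexists; split; [apply/fsetUP; left; apply: fset11|].
by exists (rtile b u); rewrite move_back; split; [apply/fsetUP; left|case: (b)].
Qed.

Lemma walker_room u b p A b' u' v' x y : walker u b p A ->
  x \in A -> y \in brick b' u' v' (move (toward b) p) -> x.1 <> y.1.
Proof.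
move=> wA /(walker_bound wA)[lt|->] /mem_brick[]-> /= e.
- by move: lt; rewrite e move_toward_fst ltxx.
- by move: lt; rewrite e /= move_toward_fst ltNge lerDl.
- by case: (move_neq (esym e)).
- by move/(congr1 fst): e; rewrite /= move_toward_fst; lia.
Qed.

Lemma walker_no_overlap v b p A : walker v b p A -> no_overlap A.
Proof.
elim=> [{}p|u w {}b {}p {}A wA nA _]; first by case: (seed_no_overlap_stable p).
apply: no_overlapU; [exact: nA|exact: brick_no_overlap|].
by move=> x y; apply: walker_room wA.
Qed.

Lemma half_str_vglue v b : half_str (vglue v b) = 1 / 2%:R.
Proof. by []. Qed.

Lemma walker_cut u b p A v : walker u b p A ->
  1 <= cutw half_str A (brick (~~ b) u v (move (toward b) p)).
Proof.
move=> wA; have hA := walker_head wA; have [t [tA ft]] := walker_prev wA.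
have lB : (move (toward b) p, ltile (~~ b) u) \in brick (~~ b) u v (move (toward b) p).
  by apply/mem_brick; left.
have neq : (p, rtile b u) != (move (toward b) (move West p), t).
  apply/eqP=> /(congr1 (fun x : ptile => x.1.1)) /=; rewrite move_toward_fst /=; lia.
apply: le_trans (bond2_le_cutw half_str_ge0 hA tA lB neq).
have -> : bond half_str (p, rtile b u) (move (toward b) p, ltile (~~ b) u) = 1 / 2%:R.
  by apply: (@bond_move _ (toward b) (vglue u b)); case: (b).
have -> : bond half_str (move (toward b) (move West p), t)
    (move (toward b) p, ltile (~~ b) u) = 1 / 2%:R.
  apply: (@bond_move _ East 1%N); [|exact: ft|by case: (b)].
  by case: (b) (p) => -[i j] /=; congr (_, _); lia.
lra.
Qed.

Lemma walker_neq0 v b p A : walker v b p A -> A != fset0.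
Proof. by move/walker_head=> hA; apply/fset0Pn; exists (p, rtile b v). Qed.

Lemma brick_neq0 b u v p : brick b u v p != fset0.
Proof. by apply/fset0Pn; exists (p, ltile b u); apply/mem_brick; left. Qed.

Lemma walker_stable v b p A : walker v b p A -> stable half_str A.
Proof.
elim=> [{}p|u w {}b {}p {}A wA sA _]; first by case: (seed_no_overlap_stable p).
apply: stable_pos_U;
  [exact: walker_neq0 wA|exact: brick_neq0| |exact: sA|exact: brick_stable|].
  by move=> x y; apply: walker_room wA.
exact: walker_cut.
Qed.

(** By induction on the ribbon: a new brick covers two of the three free glues, and its own right
    half supplies two new ones. *)
Lemma walker_exposed v b p A x d g : walker v b p A -> exposed A x d g ->
  [\/ [/\ x.1 = p, d = East & g = 1%N],
      [/\ x.1 = p, d = toward b & g = vglue v b]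
    | [/\ x.1 = move (toward b) (move West p), d = East & g = 1%N]].
Proof.
move=> wA; elim: wA x d g => {A p} [p|u w {}b p A wA IH _] x d g.
  rewrite /seed; set a := (move North _, _); set l := (move West p, _); set r := (p, _).
  have aA : a \in [fset a] `|` ([fset l] `|` [fset r]).
    by apply/fsetUP; left; apply: fset11.
  have lA : l \in [fset a] `|` ([fset l] `|` [fset r]).
    by apply/fsetUP; right; apply/fsetUP; left; apply: fset11.
  have rA : r \in [fset a] `|` ([fset l] `|` [fset r]).
    by do 2 (apply/fsetUP; right); apply: fset11.
  case=> xA fx nA; case/fsetUP: xA fx nA => [/fset1P->|/fsetUP[]/fset1P->].
  - case: d => // -[<-] nA; first by constructor 3.
    by case: (nA _ lA); rewrite (moveK North).
  - case: d => // -[<-] nA; first by case: (nA _ aA).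
    by case: (nA _ rA); rewrite (moveK West).
  - case/face_rtile=> -[-> ->] nA; [|by constructor 1|by constructor 2].
    by case: (nA _ lA).
set q := move (toward b) p.
have lB : (q, ltile (~~ b) u) \in A `|` brick (~~ b) u w q.
  by apply/fsetUP; right; apply/mem_brick; left.
have rB : (move East q, rtile (~~ b) w) \in A `|` brick (~~ b) u w q.
  by apply/fsetUP; right; apply/mem_brick; right.
have pA := walker_head wA; have [t [tA _]] := walker_prev wA.
have sA : {subset A <= A `|` brick (~~ b) u w q} by move=> z zA; apply/fsetUP; left.
case=> xA fx nA; case/fsetUP: xA => [xA|/mem_brick[]ex].
- have /IH : exposed A x d g by split=> // y /sA /nA.
  (* The east glue of the old head stays free and becomes the diagonal one; the other two old glues
     now face the new left half. *)
  case=> -[ex ed eg]; subst d g.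
  + by constructor 3; rewrite move_back.
  + by case: (nA _ lB); rewrite ex.
  + case: (nA _ lB); rewrite ex /= /q; case: (b) (p) => -[i j] /=; congr (_, _); lia.
- rewrite ex in fx nA; case/face_ltile: fx => -[ed eg]; subst d g.
  + by case: (nA _ rB).
  + case: (nA _ (sA _ tA)); rewrite /= /q; case: (b) (p) => -[i j] /=; congr (_, _); lia.
  + by case: (nA _ (sA _ pA)); rewrite /= -toward_opp moveK.
- rewrite ex in fx nA *; case/face_rtile: fx => -[ed eg]; subst d g.
  + by case: (nA _ lB); rewrite (moveK East).
  + by constructor 1.
  + by constructor 2.
Qed.

(** * Which assemblies can combine *)

(** The invariant of [PROD]: loose bricks on edges and ribbons, at any position. *)
Definition producible (A : assembly) : Prop :=
  (exists b u v p, E u v /\ A = brick b u v p) \/ (exists v b p, walker v b p A).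

(** Glue [0], the only one of strength 1, is always covered by the neighbouring tile. *)
Lemma producible_exposed A x d g : producible A -> exposed A x d g -> half_str g < 1.
Proof.
have vlt v b : half_str (vglue v b) < 1 by rewrite half_str_vglue; lra.
have lt1 : half_str 1%N < 1 by rewrite /half_str /=; lra.
case=> [[b [u [v [p [_ ->]]]]] /brick_exposed|[v [b [p wA]]] /(walker_exposed wA)].
  by case=> -[_ _ ->].
by case=> -[_ _ ->].
Qed.

Lemma producible_cooperates A B : producible A -> apart A B ->
  1 <= cutw half_str A B ->
  exists x1 y1 d1 g1 x2 y2 d2 g2, (x1, y1) <> (x2, y2) /\
    [/\ y1.1 = move d1 x1.1, exposed A x1 d1 g1 & exposed B y1 (opp_dir d1) g1] /\
    [/\ y2.1 = move d2 x2.1, exposed A x2 d2 g2 & exposed B y2 (opp_dir d2) g2].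
Proof.
move=> pA dAB /cutw_cooperates[|x1 [y1 [x2 [y2 [neq [x1A x2A] [y1B y2B] b1 b2]]]]].
  move=> x y xA yB; have [->|] := eqVneq (bond half_str x y) 0; first exact: ltr01.
  case/(bond_exposed dAB xA yB)=> d [g [_ ex _ ->]]; exact: producible_exposed ex.
have [d1 [g1 [m1 ex1 ey1 _]]] := bond_exposed dAB x1A y1B b1.
have [d2 [g2 [m2 ex2 ey2 _]]] := bond_exposed dAB x2A y2B b2.
by exists x1, y1, d1, g1, x2, y2, d2, g2.
Qed.

Lemma no_opposite_towards b : opp_dir (toward b) <> toward b.
Proof. by case: b. Qed.

(* The offset between two bricks determines the only pair of faces that can match. *)
Lemma brick_brick_cut b u v p b' u' v' p' :
  E u v -> apart (brick b u v p) (brick b' u' v' p') ->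
  cutw half_str (brick b u v p) (brick b' u' v' p') < 1.
Proof.
move=> uv dAB; rewrite ltNge; apply/negP.
case/(producible_cooperates _ dAB); first by left; exists b, u, v, p.
have key x y d g : y.1 = move d x.1 -> exposed (brick b u v p) x d g ->
    exposed (brick b' u' v' p') y (opp_dir d) g ->
    [\/ [/\ x = (p, ltile b u), y = (move East p', rtile b' v') & p'.1 = p.1 - 2%:R],
        [/\ x = (p, ltile b u), y = (move East p', rtile b' v') & p'.1 = p.1 - 1],
        [/\ x = (move East p, rtile b v), y = (p', ltile b' u') & p'.1 = p.1 + 2%:R]
      | [/\ x = (move East p, rtile b v), y = (p', ltile b' u') & p'.1 = p.1 + 1]].
  move=> m /brick_exposed ex /brick_exposed ey.
  case: ex ey m => -[-> -> ->] [] [-> ed eg] m; try (by case: (b) ed);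
    try (by case: (b') ed); try (by case: (b) eg); try (by case: (b') eg).
  - constructor 1; split=> //; move/(congr1 fst): m => /=; lia.
  (* Two left halves: equal glues force equal parities, and then both faces point the same way. The
     last case treats two right halves alike. *)
  - by have [_ eb] := vglue_inj eg; case: (b) (b') ed eb => -[].
  - constructor 2; split=> //; move/(congr1 fst): m; rewrite move_toward_fst /=; lia.
  - constructor 3; split=> //; move/(congr1 fst): m => /=; lia.
  - constructor 4; split=> //; move/(congr1 fst): m; rewrite move_toward_fst /=; lia.
  - by have [_ eb] := vglue_inj eg; case: (b) (b') ed eb => -[].
move=> x1 [y1 [d1 [g1 [x2 [y2 [d2 [g2 [neq [[m1 ex1 ey1] [m2 ex2 ey2]]]]]]]]]].
by case: (key _ _ _ _ m1 ex1 ey1) => -[e1 e2 e3];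
  case: (key _ _ _ _ m2 ex2 ey2) => -[e4 e5 e6]; try (exfalso; lia);
  apply: neq; congr (_, _); congruence.
Qed.

(** Not even one contact exists: no ribbon exposes a west glue, and equal vertex glues force equal
    parities, hence equal rather than opposite directions. *)
Lemma walker_walker_cut u b p A u' b' p' A' :
  walker u b p A -> walker u' b' p' A' -> apart A A' -> cutw half_str A A' < 1.
Proof.
move=> wA wA' dAB; rewrite ltNge; apply/negP.
case/(producible_cooperates _ dAB); first by right; exists u, b, p.
move=> x [y [d [g [_ [_ [_ [_ [_ [[_ ex ey] _]]]]]]]]].
move: (walker_exposed wA ex) (walker_exposed wA' ey).
case=> -[_ -> ->] [] [_ ed eg]; try (by case: (b) ed); try (by case: (b') ed); try by [].
by have [_ eb] := vglue_inj eg; rewrite eb in ed; case: (no_opposite_towards ed).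
Qed.

(** Every contact uses the left half of the brick, and there is only one possible horizontal
    contact. Of two distinct contacts one is therefore vertical, and it alone fixes parity, vertex
    and position. *)
Lemma walker_brick_cut u b p A b' u' v' q :
  walker u b p A -> apart A (brick b' u' v' q) ->
  1 <= cutw half_str A (brick b' u' v' q) ->
  [/\ b' = ~~ b, u' = u & q = move (toward b) p].
Proof.
move=> wA dAB; case/(producible_cooperates _ dAB); first by right; exists u, b, p.
have key x y d g : y.1 = move d x.1 -> exposed A x d g ->
    exposed (brick b' u' v' q) y (opp_dir d) g ->
    y = (q, ltile b' u') /\
    (x.1 = move West q \/ [/\ b' = ~~ b, u' = u, q = move (toward b) p & x.1 = p]).
  move=> m /(walker_exposed wA) ex /brick_exposed ey.
  case: ex ey m => -[ex -> ->] [] [-> ed eg] m;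
    try (by case: (b) ed); try (by case: (b') ed); try by [].
  - by split=> //; left; have -> : q = move East x.1 := m; rewrite (moveK East).
  - have [-> eb] := vglue_inj eg; split=> //; right; have mq : q = move (toward b) x.1 := m.
    by split; [rewrite eb negbK| |rewrite mq ex|].
  - have [_ eb] := vglue_inj eg; rewrite eb in ed; by case: (no_opposite_towards ed).
  - by split=> //; left; have -> : q = move East x.1 := m; rewrite (moveK East).
move=> x1 [y1 [d1 [g1 [x2 [y2 [d2 [g2 [neq [[m1 ex1 ey1] [m2 ex2 ey2]]]]]]]]]].
have [ey1' [xW1|[]]] := key _ _ _ _ m1 ex1 ey1; last by split.
have [ey2' [xW2|[]]] := key _ _ _ _ m2 ex2 ey2; last by split.
(* Two horizontal contacts would both use the tile west of [q]. *)
case: neq; rewrite ey1' ey2'; congr (_, _).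
case: ex1 ex2 => [x1A _ _] [x2A _ _].
by apply: (walker_no_overlap wA); rewrite // xW1.
Qed.

Lemma apart_sym A B : apart A B -> apart B A.
Proof. by move=> dAB x y xB yA /esym; apply: dAB. Qed.

Lemma producible_stable A : producible A -> stable half_str A.
Proof.
case=> [[b [u [v [p [_ ->]]]]]|[v [b [p wA]]]]; [exact: brick_stable|exact: walker_stable wA].
Qed.

Lemma producible_unbreakable A B C : producible A -> ~ breakable half_str A B C.
Proof. by move=> /producible_stable sA [/sA]; case: ltgtP. Qed.

Lemma producible_translate c A : producible A -> producible (translate c A).
Proof.
case=> [[b [u [v [p [uv ->]]]]]|[v [b [p wA]]]]; [left|right].
  by exists b, u, v, (p.1 + c.1, p.2 + c.2); split=> //; apply: translate_brick.
by exists v, b, (p.1 + c.1, p.2 + c.2); apply: translate_walker.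
Qed.

Lemma combinable_apart A B C : combinable half_str A B C ->
  exists c, [/\ apart A (translate c B), C = A `|` translate c B
    & 1 <= cutw half_str A (translate c B)].
Proof.
case=> c [nAB dAB eC cAB]; exists c; split=> // x y xA yB e.
have exy : x = y by apply: nAB; rewrite // in_fsetU ?xA ?yB ?orbT.
by move/fdisjointP/(_ x xA): dAB; rewrite exy yB.
Qed.

Lemma walker_combine u b p A B : walker u b p A -> producible B -> apart A B ->
  1 <= cutw half_str A B ->
  exists v, E u v /\ B = brick (~~ b) u v (move (toward b) p).
Proof.
move=> wA pB dAB cAB; case: pB => [[b' [u' [v [q [uv eB]]]]]|[v [b' [q wB]]]].
  rewrite eB in dAB cAB *; have [eb eu eq] := walker_brick_cut wA dAB cAB.
  by subst; exists v.
by have := walker_walker_cut wA wB dAB; rewrite ltNge cAB.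
Qed.

(** Two bricks are too weakly bound; as soon as a ribbon takes part, on either side,
    [walker_combine] makes the other assembly a brick on an edge leaving its current vertex. *)
Lemma producible_combine A B : producible A -> producible B -> apart A B ->
  1 <= cutw half_str A B -> producible (A `|` B).
Proof.
move=> pA pB dAB cAB; case: (pA) => [[b [u [v [p [uv eA]]]]]|[u [b [p wA]]]]; last first.
  have [v [uv ->]] := walker_combine wA pB dAB cAB.
  by right; do 3 eexists; apply: walker_step.
case: (pB) => [[b' [u' [v' [p' [_ eB]]]]]|[u' [b' [p' wB]]]].
  by subst; have := brick_brick_cut uv dAB; rewrite ltNge cAB.
rewrite cutwC in cAB; have [w [uw ->]] := walker_combine wB pA (apart_sym dAB) cAB.
by rewrite fsetUC; right; do 3 eexists; apply: walker_step.
Qed.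

(** * The initial assembly set *)

Definition edges : {set bool * (V * V)} :=
  setX [set: bool] [set e : V * V | E e.1 e.2].

Definition system : {fset assembly} :=
  seed (0, 0) |` seq_fset tt [seq brick t.1 t.2.1 t.2.2 (0, 0) | t <- enum edges].

Lemma mem_system A : A \in system <->
  A = seed (0, 0) \/ exists b u v, E u v /\ A = brick b u v (0, 0).
Proof.
split=> [/fset1UP[->|]|[->|[b [u [v [uv ->]]]]]]; first by left.
- rewrite seq_fsetE => /mapP[[b [u v]]]; rewrite mem_enum => /setXP[_].
  by rewrite inE => uv ->; right; exists b, u, v.
- by apply/fset1UP; left.
- apply/fset1UP; right; rewrite seq_fsetE; apply/mapP; exists (b, (u, v)) => //.
  by rewrite mem_enum; apply/setXP; split; rewrite ?in_setT // inE.
Qed.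

Lemma card_fsetU_le (A B : assembly) : (#|` A `|` B| <= #|` A| + #|` B|)%N.
Proof. by rewrite cardfsU leq_subr. Qed.

Lemma card_fset1U_le x (A : assembly) : (#|` [fset x] `|` A| <= #|` A|.+1)%N.
Proof. by rewrite (leq_trans (card_fsetU_le _ _)) // cardfs1. Qed.

Lemma card_brick b u v p : (#|` brick b u v p| <= 2)%N.
Proof. by rewrite /brick; apply: (leq_trans (card_fset1U_le _ _)); rewrite cardfs1. Qed.

Lemma card_seed p : (#|` seed p| <= 3)%N.
Proof.
rewrite /seed; apply: (leq_trans (card_fset1U_le _ _)); rewrite ltnS.
by apply: (leq_trans (card_fset1U_le _ _)); rewrite cardfs1.
Qed.

(** One seed and at most two bricks per edge; the seed is paid for by the vertex [s]. *)
Lemma card_system : (#|` system| <= 2 * (#|V| + num_edges E))%N.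
Proof.
have V_gt0 : (0 < #|V|)%N by apply/card_gt0P; exists s.
have le : (#|` system| <= 1 + size (enum edges))%N.
  rewrite /system cardfsU1 size_seq_fset leq_add ?leq_b1 //.
  by rewrite (leq_trans (size_undup _)) // size_map.
apply: leq_trans le _; rewrite -cardE cardsX cardsT card_bool /num_edges; lia.
Qed.

(** The breaking rules never apply, since every assembly satisfying the invariant is stable. *)
Lemma PROD_producible A : PROD half_str system A -> producible A.
Proof.
elim=> {A} [A /mem_system[->|[b [u [v [uv ->]]]]]|A B C _ pA _ pB|C A B _ pC|C A B _ pC].
- by right; exists s, false, (0, 0); apply: walker_seed.
- by left; exists b, u, v, (0, 0).
- case/combinable_apart=> c [dAB -> cAB].
  by apply: producible_combine => //; apply: producible_translate.
- by move/(producible_unbreakable pC).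
- by move/(producible_unbreakable pC).
Qed.

(** * Assembly sequences as walks *)

Lemma walker_label v b p A : walker v b p A -> has_label 0 A.
Proof.
elim=> [{}p|u w {}b {}p {}A _ [x [xA lx]] _].
  by eexists; split; [apply/fsetUP; left; apply: fset11|].
by exists x; split=> //; apply/fsetUP; left.
Qed.

Lemma brick_unlabelled b u v p : ~ has_label 0 (brick b u v p).
Proof. by case=> x [/mem_brick[]->]; case: b. Qed.

(** Read off the rightmost tile, which is unique in a walker. *)
Definition current (A : assembly) : option V :=
  [pick v | has (fun x : ptile => ((tN x.2 == Some (vglue v false))
       || (tS x.2 == Some (vglue v true)))
     && all (fun y : ptile => y.1.1 <= x.1.1) A) A].

Lemma current_walker v b p A : walker v b p A -> current A = Some v.
Proof.
move=> wA; have hA := walker_head wA.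
rewrite /current; case: pickP => [v' /hasP[x xA /andP[glue_x /allP xmax]]|/(_ v) /negP[]].
  (* A tile of maximal column is the head, whose vertex glue determines [v]. *)
  have ex : x = (p, rtile b v).
    apply: (walker_no_overlap wA) => //.
    by case: (walker_bound wA xA) => // lt; have := xmax _ hA; rewrite leNgt lt.
  move: glue_x; rewrite ex /=.
  by case: (b) => /orP[] // /eqP[] /eqP; rewrite eqn_add2r
    => /eqP/double_inj/ord_inj/enum_rank_inj->.
apply/hasP; exists (p, rtile b v) => //; apply/andP; split.
  by case: (b); rewrite /= eqxx.
by apply/allP=> y yA; case: (walker_bound wA yA) => [/ltW|->].
Qed.

Lemma walker_seq_step u b p A A' : walker u b p A -> seq_step half_str system A A' ->
  exists v p', [/\ E u v, walker v (~~ b) p' A' & (#|` A'| <= #|` A| + 2)%N].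
Proof.
move=> wA; case=> [[B [/PROD_producible pB /combinable_apart[c [dAB -> cAB]]]]|[B brk]].
  have [v [uv ->]] := walker_combine wA (producible_translate c pB) dAB cAB.
  exists v; eexists; split; [exact: uv|exact: walker_step|].
  by apply: leq_trans (card_fsetU_le _ _) _; rewrite leq_add2l card_brick.
by case: (@producible_unbreakable A A' B) => //; right; exists u, b, p.
Qed.

Lemma walker_steps u b p A S : walker u b p A -> steps half_str system (A :: S) ->
  exists vs, [/\ pmap current (A :: S) = u :: vs, path E u vs
    & (fuel_seq (A :: S) <= 2 * size vs)%N].
Proof.
elim: S u b p A => [|A' S IH] u b p A wA.
  by exists [::]; rewrite /= (current_walker wA).
case=> /(walker_seq_step wA)[v [p' [uv wA' cA']]] /(IH _ _ _ _ wA')[vs [evs pvs fvs]].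
exists (v :: vs); split; rewrite /= ?uv //.
  by rewrite (current_walker wA); congr (_ :: _); exact: evs.
move: fvs; rewrite [X in (X <= _)%N -> _]/= /fuel; lia.
Qed.

Lemma walker_advance u b p A v : walker u b p A -> E u v ->
  seq_step half_str system A (A `|` brick (~~ b) u v (move (toward b) p)).
Proof.
(* The brick is supplied at the origin, so the translation vector is its target cell. *)
move=> wA uv; left; exists (brick (~~ b) u v (0, 0)); split.
  by apply/PROD_init/mem_system; right; exists (~~ b), u, v.
exists (move (toward b) p); rewrite translate_brick /= !add0r -surjective_pairing.
have dAB : apart A (brick (~~ b) u v (move (toward b) p)).
  by move=> x y; apply: walker_room wA.
split=> //; [exact: walker_no_overlap (walker_step wA uv)|exact: disjoint_pos|].
exact: walker_cut.
Qed.

(** The initial ribbon is arbitrary: the lemma serves both to realise a walk from the seed and to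
    extend a given sequence by one edge. *)
Lemma walker_path u b p A vs : walker u b p A -> PROD half_str system A ->
  path E u vs -> exists S, [/\ forall B, B \in A :: S -> PROD half_str system B,
    steps half_str system (A :: S), focused 0 (A :: S) & pmap current S = vs].
Proof.
elim: vs u b p A => [|v vs IH] u b p A wA PA /=.
  by exists [::]; split=> // B; rewrite inE => /eqP-> //; apply: walker_label wA.
case/andP=> uv pvs; have wA' := walker_step wA uv; have st := walker_advance wA uv.
move: (A `|` _) wA' st => A' wA' st.
have PA' : PROD half_str system A'.
  by case: st => [[B [PB cmb]]|[B brk]]; [apply: PROD_comb cmb|apply: PROD_brk1 brk].
have [S [PS stS fS eS]] := IH _ _ _ _ wA' PA' pvs.
exists (A' :: S); split; last by rewrite /= (current_walker wA') eS.
- by move=> B; rewrite inE => /orP[/eqP->|/PS].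
- by split.
- by move=> B; rewrite inE => /orP[/eqP->|/fS //]; apply: walker_label wA.
Qed.

(** Label [0] occurs only on the seed, so a focused sequence consists of ribbons. *)
Lemma labelled_walker A : PROD half_str system A -> has_label 0 A ->
  exists v b p, walker v b p A.
Proof. by case/PROD_producible=> // -[b [u [v [p [_ ->]]]]] /brick_unlabelled. Qed.

Lemma nascent_walker A : A \in system -> has_label 0 A -> A = seed (0, 0).
Proof. by case/mem_system=> // -[b [u [v [_ ->]]]] /brick_unlabelled. Qed.

Lemma nascent_walk S : valid_seq half_str system S -> focused 0 S -> nascent system S ->
  exists vs, [/\ pmap current S = s :: vs, path E s vs & (fuel_seq S <= 2 * size vs)%N].
Proof.
move=> [_ [_ stS]] fS [A [S' [eS AT]]]; subst S.
have eA : A = seed (0, 0) by apply: nascent_walker AT (fS _ (mem_head _ _)).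
by subst A; apply: walker_steps stS; apply: walker_seed.
Qed.

Lemma system_walks : walks half_str system 0 E s current.
Proof.
have seedT : PROD half_str system (seed (0, 0)) by apply/PROD_init/mem_system; left.
split=> [S vS fS nS|W [vs [-> pvs]]|u v uv S [S0 [PS stS]] fS eS].
- by have [vs [evs pvs _]] := nascent_walk vS fS nS; exists vs.
- have w0 := walker_seed (0, 0); have [S [PS stS fS eS]] := walker_path w0 seedT pvs.
  exists (seed (0, 0) :: S); split=> //.
    by exists (seed (0, 0)), S; split=> //; apply/mem_system; left.
  by rewrite /fprime /= (current_walker w0) eS.
(* Since [current] is defined on every ribbon, a focused sequence whose image is the single vertex
   [u] has just one element. *)
have cur A : A \in S -> exists v b p, walker v b p A.
  by move=> AS; apply: labelled_walker; [apply: PS|apply: fS].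
case: S S0 PS stS fS eS cur => [//|A S] _ PS stS fS eS cur.
have [w [b [p wA]]] := cur A (mem_head _ _).
case: S PS stS fS eS cur => [|A' S] PS stS fS; last first.
  move=> + cur; have A'S : A' \in [:: A, A' & S] by rewrite inE mem_head orbT.
  have [w' [b' [p' wA']]] := cur A' A'S.
  by rewrite /fprime /= (current_walker wA) (current_walker wA').
rewrite /fprime /= (current_walker wA) => -[ew] _; subst w.
have pv : path E u [:: v] by rewrite /= uv.
have [R [PR stR fR eR]] := walker_path wA (PS _ (mem_head _ _)) pv.
exists R; split; [by split|exact: fR|].
by rewrite /fprime /= eR.
Qed.

Lemma system_fuel_efficient : fuel_efficient half_str system 0 current.
Proof.
exists 2 => S vS fS nS; have [vs [evs _ le]] := nascent_walk vS fS nS.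
(* The image lists one vertex more than the number of edges traversed. *)
by apply: leq_trans le _; rewrite /fprime evs leq_mul2l leqnSn.
Qed.

Lemma system_initial : initial_ok half_str system.
Proof.
move=> A /mem_system[->|[b [u [v [_ ->]]]]].
  have w0 := walker_seed (0, 0).
  by split; [split; [exact: walker_neq0 w0|exact: walker_no_overlap w0]|exact: walker_stable w0].
by split; [split; [exact: brick_neq0|exact: brick_no_overlap]|exact: brick_stable].
Qed.

Lemma card_initial A : A \in system -> (#|` A| <= 3)%N.
Proof.
case/mem_system=> [->|[b [u [v [_ ->]]]]]; first exact: card_seed.
exact: leq_trans (card_brick _ _ _ _) _.
Qed.

End Tiles.

Theorem theorem1 :
  exists c1 c2 : nat,
    forall (V : finType) (E : rel V) (s : V),
      exists (str : glue -> rat) (T : {fset assembly}) (l : nat)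
             (f : assembly -> option V),
        [/\ initial_ok str T,
            walks str T l E s f,
            fuel_efficient str T l f,
            (#|` T| <= c1 * (#|V| + num_edges E))%N
          & forall a, a \in T -> (#|` a| <= c2)%N].
Proof.
(* Two bricks per edge, and three tiles in the seed, the largest initial assembly. *)
exists 2, 3 => V E s; exists half_str, (system E s), 0, (@current V).
split; [exact: system_initial|exact: system_walks|exact: system_fuel_efficient| |].
  exact: card_system.
exact: card_initial.
Qed.
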